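(* Let $c\ge 0$ be the regularization parameter, let $\ell\ge1$ be the required margin, let $y_n\in\{+1,-1\}$, and let $\tilde{\mathbf x}_n$ be the random corrupted feature vectors in $\mathbb R^D$, $n=1,\dots,N$. For $\mathbf w\in\mathbb R^D$ put $\zeta_n=\ell-y_n\mathbf w^\top\tilde{\mathbf x}_n$ and define the expected hinge loss $\mathcal L_h(\mathbf w)=\sum_{n=1}^N\mathbb E_p[\max(0,\zeta_n)]$. For every $\mathbf w$ and every (normalized) variational distribution $q(\boldsymbol\lambda)$ of the augmented variables $\boldsymbol\lambda=(\lambda_1,\dots,\lambda_N)$, $\lambda_n\in(0,\infty)$, the expected hinge loss multiplied by $2c$ has the variational upper bound $$2c\,\mathcal L_h(\mathbf w)\;\le\;\mathcal L_h(\mathbf w,q(\boldsymbol\lambda)):=-H(\boldsymbol\lambda)+\sum_{n=1}^N\Big\{\frac12\mathbb E_q[\log\lambda_n]+\mathbb E_q\Big[\frac{1}{2\lambda_n}\mathbb E_p\big[(\lambda_n+c\zeta_n)^2\big]\Big]\Big\}+c',$$ where $c'$ is a constant (depending on neither $\mathbf w$ nor $q$). Moreover, when there is no feature noise (that is, $\tilde{\mathbf x}_n=\mathbf x_n$ for all $n$), the bound is tight: for every $\mathbf w$, the optimal $q$ gives the original hinge loss, i.e. $\min_q\mathcal L_h(\mathbf w,q(\boldsymbol\lambda))=2c\sum_{n=1}^N\max(0,\ell-y_n\mathbf w^\top\mathbf x_n)$, so that minimizing $\|\mathbf w\|_2^2+\mathcal L_h(\mathbf w,q(\boldsymbol\lambda))$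 over $\mathbf w$ and $q$ amounts to learning the standard SVM classifier.
   Context: Data: $(\mathbf x_n,y_n)$, $n=1,\dots,N$, with $\mathbf x_n\in\mathbb R^D$. Each $\tilde{\mathbf x}_n$ is a random vector, a corrupted version of $\mathbf x_n$, drawn from a corrupting distribution $p(\tilde{\mathbf x}_n\mid\mathbf x_n)=\prod_{d=1}^D p(\tilde x_{nd}\mid x_{nd};\eta_d)$ with independent coordinates, each factor being a member of the exponential family with natural parameter $\eta_d$, and unbiased: $\mathbb E_p[\tilde{\mathbf x}_n\mid\mathbf x_n]=\mathbf x_n$. $\mathbb E_p$ denotes expectation under the corrupting distribution, $\mathbb E_q$ denotes expectation of $\boldsymbol\lambda$ under $q(\boldsymbol\lambda)$ (which does not depend on the random corruption), and $H(\boldsymbol\lambda)=-\mathbb E_q[\log q(\boldsymbol\lambda)]$ is the entropy of $q(\boldsymbol\lambda)$. The offset of the linear classifier is treated implicitly by augmenting $\mathbf x_n$ and $\tilde{\mathbf x}_n$ with one deterministic coordinate equal to $1$; the offset is not regularized. The standard SVM problem is the minimization over $\mathbf w$ of $\|\mathbf w\|_2^2+2c\sum_{n=1}^N\max(0,\ell-y_n\mathbf w^\top\mathbf x_n)$. *)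

(* Defs.v *)
From HB Require Import structures.
From mathcomp Require Import all_boot all_order all_algebra.
From mathcomp Require Import all_classical all_reals all_analysis.

Set Implicit Arguments.
Unset Strict Implicit.
Unset Printing Implicit Defensive.

Import Order.TTheory GRing.Theory Num.Theory.

Local Open Scope classical_set_scope.
Local Open Scope ring_scope.

(* Lebesgue measure on R^n; see [lebesgue_tuple_box]. *)
Section lebesgue_tuple.
Context {R : realType}.

Definition cons_pair n (p : R * n.-tuple R) : n.+1.-tuple R :=
  [tuple of p.1 :: p.2].

Lemma measurable_cons_pair n : measurable_fun setT (@cons_pair n).
Proof. exact: (measurable_cons measurable_fst measurable_snd). Qed.

Section step.
Context n (mu : {sigma_finite_measure set (n.-tuple R) -> \bar R}).

Definition lebesgue_step : set (n.+1.-tuple R) -> \bar R :=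
  pushforward (@lebesgue_measure R \x mu)%E (@cons_pair n).

Let step0 : lebesgue_step set0 = 0%E.
Proof. by rewrite /lebesgue_step /pushforward preimage_set0 measure0. Qed.

Let step_ge0 A : (0 <= lebesgue_step A)%E.
Proof. by rewrite /lebesgue_step /pushforward measure_ge0. Qed.

Let step_sigma_additive : semi_sigma_additive lebesgue_step.
Proof.
move=> F mF tF mUF; rewrite /lebesgue_step /pushforward preimage_bigcup.
apply: (@measure_semi_sigma_additive _ _ _ (@lebesgue_measure R \x mu)%E).
- by move=> k; rewrite -[X in measurable X]setTI; exact: measurable_cons_pair.
- apply/trivIsetP => /= i j _ _ ij; rewrite -preimage_setI.
  by move/trivIsetP : tF => /(_ _ _ _ _ ij) ->//; rewrite preimage_set0.
- rewrite -preimage_bigcup -[X in measurable X]setTI.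
  exact: measurable_cons_pair.
Qed.

HB.instance Definition _ := isMeasure.Build _ _ _
  lebesgue_step step0 step_ge0 step_sigma_additive.

Let step_sigma_finite : sigma_finite setT lebesgue_step.
Proof.
have /sigma_finiteP[F [FT ndF Foo]] := sigma_finiteT (@lebesgue_measure R).
have /sigma_finiteP[G [GT ndG Goo]] := sigma_finiteT mu.
pose g (t : n.+1.-tuple R) : R * n.-tuple R := (thead t, [tuple of behead t]).
have mg : measurable_fun setT g.
  apply/measurable_fun_pairP; split.
    exact: measurable_tnth.
  exact: measurable_behead.
have gK : cancel (@cons_pair n) g.
  by case=> a t; rewrite /g /cons_pair; congr pair; apply/val_inj.
exists (fun k => g @^-1` (F k `*` G k)).
  apply/esym; rewrite -subTset => t _; have : [set: R] (thead t) by [].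
  have : [set: n.-tuple R] [tuple of behead t] by [].
  rewrite FT GT => -[j _ Gj] [i _ Fi]; exists (maxn i j) => //; split => /=.
    by move: Fi; exact/subsetPset/ndF/leq_maxl.
  by move: Gj; exact/subsetPset/ndG/leq_maxr.
move=> k; have [mF Fk] := Foo k; have [mG Gk] := Goo k; split.
  by rewrite -[X in measurable X]setTI; apply: mg => //; exact: measurableX.
rewrite /lebesgue_step /pushforward -comp_preimage (_ : g \o _ = id).
  by rewrite preimage_id product_measure1E// lte_mul_pinfty// ge0_fin_numE.
by apply/funext => x /=; exact: gK.
Qed.

HB.instance Definition _ :=
  Measure_isSigmaFinite.Build _ _ _ lebesgue_step step_sigma_finite.
End step.

Fixpoint lebesgue_tuple n : {sigma_finite_measure set (n.-tuple R) -> \bar R} :=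
  match n with
  | 0 => \d_([tuple] : 0.-tuple R)
  | n'.+1 => lebesgue_step (lebesgue_tuple n')
  end.

Lemma lebesgue_tuple_box n (A : 'I_n -> set R) :
  (forall i, measurable (A i)) ->
  lebesgue_tuple n [set t | forall i, A i (tnth t i)] =
    (\prod_(i < n) lebesgue_measure (A i))%E.
Proof.
elim: n A => [|n IH] A mA /=.
  by rewrite big_ord0 diracE mem_set //= => -[].
rewrite big_ord_recl -IH //.
have mB : measurable
    [set t : n.-tuple R | forall i, A (lift ord0 i) (tnth t i)].
  rewrite (_ : [set t | _] = \bigcap_(i in setT)
      (fun t : n.-tuple R => tnth t i) @^-1` (A (lift ord0 i))).
    apply: fin_bigcap_measurable => // i _.
    by rewrite -[X in measurable X]setTI; exact: measurable_tnth.
  by apply/seteqP; split=> [t h i _|t h i]; exact: h.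
rewrite -product_measure1E //; last exact: mA.
rewrite /lebesgue_step /pushforward.
set S1 := (X in product_measure1 _ _ X = _).
set S2 := (X in _ = product_measure1 _ _ X).
suff -> : S1 = S2 by [].
rewrite /S1 /S2; apply/seteqP; split=> [[a t] /= h|[a t] /= [h0 h] i].
  split; first exact: (h ord0).
  by move=> i; have := h (lift ord0 i); rewrite tnthS.
case: (unliftP ord0 i) => [j ->|->]; first by rewrite tnthS; exact: h.
exact: h0.
Qed.

End lebesgue_tuple.

Section variational_bound.
Context {R : realType}.

Definition dotv k (u v : 'rV[R]_k) : R := \sum_i u 0 i * v 0 i.

(* [p] has density exp(<eta, T z> - A) with respect to a base measure [mu]
   (which absorbs the carrier factor usually written h), A being the
   log-partition value at [eta].  The base measure and the sufficient statistic
   may depend on the uncorrupted value; only [eta] is shared. *)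
Definition exponential_family_member k (eta : 'rV[R]_k) (p : set R -> \bar R) :=
  exists (mu : {sigma_finite_measure set R -> \bar R}) (T : R -> 'rV[R]_k)
         (A : R),
  [/\ forall i, measurable_fun setT (fun z => T z 0 i),
      (\int[mu]_z (expR (dotv eta (T z)))%:E = (expR A)%:E)%E
    & forall B, measurable B ->
      p B = (\int[mu]_(z in B) (expR (dotv eta (T z) - A))%:E)%E].

Section corruption.
Context d (Omega : measurableType d) (P : probability Omega R) (N D : nat).

(* [offset = Some j]: coordinate [j] is the constant 1 appended to the features
   to carry the offset of the classifier.  [offset = None]: no offset.
   [p j v] is the corrupting law of coordinate [j] given the clean value [v];
   [corruption_law] says that the coordinates of the n-th vector are independent
   with these laws.  The joint law across different n is unrestricted. *)
Record corruption (offset : option 'I_D) (x : 'I_N -> 'rV[R]_D)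
    (k : 'I_D -> nat) (eta : forall j, 'rV[R]_(k j))
    (p : 'I_D -> R -> probability R R)
    (X : 'I_N -> 'I_D -> {RV P >-> R}) : Prop := Corruption {
  corruption_law : forall n (B : 'I_D -> set R), (forall j, measurable (B j)) ->
    P [set t | forall j, B j (X n j t)] =
      (\prod_(j < D) p j (x n 0%R j) (B j))%E ;
  corruption_expfam : forall n (j : 'I_D), offset != Some j ->
    exponential_family_member (eta j) (p j (x n 0 j)) ;
  corruption_unbiased : forall n j, 'E_P[X n j]%E = (x n 0 j)%:E ;
  corruption_offset : forall n j, offset = Some j ->
    x n 0 j = 1 /\ {ae P, forall t, X n j t = 1} }.

Definition noiseless (x : 'I_N -> 'rV[R]_D) (X : 'I_N -> 'I_D -> {RV P >-> R}) :=
  forall n j, {ae P, forall t, X n j t = x n 0 j}.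

Context (c ell : R) (y : 'I_N -> R) (X : 'I_N -> 'I_D -> {RV P >-> R}).

Definition zeta (w : 'rV[R]_D) n (t : Omega) : R :=
  ell - y n * dotv w (\row_j X n j t).

Definition expected_hinge (w : 'rV[R]_D) : \bar R :=
  (\sum_(n < N) 'E_P[fun t => Num.max 0%R (zeta w n t)])%E.

Definition positive_orthant : set (N.-tuple R) :=
  [set l | forall n, 0 < tnth l n].

(* variational distributions are given by their Lebesgue density *)
Definition is_density (q : N.-tuple R -> R) :=
  [/\ measurable_fun positive_orthant q,
      forall l, positive_orthant l -> 0 <= q l
    & (\int[lebesgue_tuple N]_(l in positive_orthant) (q l)%:E = 1)%E].

Definition qexpectation (q : N.-tuple R -> R) (f : N.-tuple R -> \bar R) : \bar R :=
  (\int[lebesgue_tuple N]_(l in positive_orthant) (f l * (q l)%:E))%E.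

Definition entropy (q : N.-tuple R -> R) : \bar R :=
  (- qexpectation q (fun l => (ln (q l))%:E))%E.

(* The sums are those of the dual scope, for which +oo + -oo = +oo: a [q] for
   which two terms are opposite infinities gets the value +oo.  In all other
   cases this is the usual addition. *)
Definition variational_bound (c' : R) (w : 'rV[R]_D) (q : N.-tuple R -> R) :
    \bar R :=
  (- entropy q
   + \sum_(n < N)
       ((2^-1)%:E * qexpectation q (fun l => (ln (tnth l n))%:E)
        + qexpectation q (fun l => (2 * tnth l n)^-1%:E *
                 'E_P[fun t => ((tnth l n + c * zeta w n t) ^+ 2)%R]%E)%E)
   + c'%:E)%dE.

End corruption.

Section svm.
Context (N D : nat) (offset : option 'I_D) (c ell : R) (x : 'I_N -> 'rV[R]_D)
  (y : 'I_N -> R).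

Definition hinge (w : 'rV[R]_D) : R :=
  \sum_(n < N) Num.max 0 (ell - y n * dotv w (x n)).

(* the offset is not regularized *)
Definition sqnorm (w : 'rV[R]_D) : R :=
  \sum_(j < D | offset != Some j) w 0 j ^+ 2.

Definition svm_objective (w : 'rV[R]_D) : R := sqnorm w + 2 * c * hinge w.

End svm.
End variational_bound.

(* Main.v *)
Require Import Defs.
From HB Require Import structures.
From mathcomp Require Import all_boot all_order all_algebra.
From mathcomp Require Import all_classical all_reals all_analysis.
From mathcomp Require Import measurable_realfun ring lra.

Set Implicit Arguments.
Unset Strict Implicit.
Unset Printing Implicit Defensive.

Import Order.TTheory GRing.Theory Num.Theory.
Import numFieldNormedType.Exports.

Local Open Scope classical_set_scope.
Local Open Scope ring_scope.

(* With u = c zeta, a = E[u] and b = sqrt(E[u^2]), the term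
   E[(l + u)^2] / (2 l) equals l / 2 + a + b^2 / (2 l), and
   l^(-1/2) exp(- l / 2 - b^2 / (2 l)) has integral (2 pi)^(1/2) exp(- b) over
   l > 0.  Gibbs' inequality against the product of the normalized laws bounds
   the objective below by the sum of the a + b, with equality when q is that
   product; and a + b >= E[u] + E|u| = 2 c E[max(0, zeta)], with equality when
   zeta is almost surely constant.  The case analysis is there to exclude the
   values +oo - oo = -oo of the integrals defining the objective. *)

(** Since (l - b)^2 / l is the square of sqrt l - b / sqrt l, the normalizing integral comes from an
    explicit antiderivative built on the standard normal distribution function. The obstacle is that
    the objective is a sum of separate extended integrals, which merge into a relative entropy only
    once each of them is finite. In the lower bound, |a| <= b makes the quadratic terms nonnegative;
    if all their integrals are finite, every coordinate has a finite mean under q, and this controls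
    the entropy and the logarithms. For equality, finiteness under the optimal law needs estimates
    near 0 and at infinity, made elementary by the variable r = l^(1/4). An infinite second moment
    of c zeta is treated apart, the bound being +oo then. *)

(** * Improper integrals over the open half-line *)

Section integral_by_antiderivative.
Context {R : realType}.
Notation mu := (@lebesgue_measure R).

(** Monotone convergence along the half-lines from 1 / (k + 1), since [f] may blow up at 0. The
    limit [m] need not be [F 0]: because division by 0 gives 0, [rig_cdf b 0] is not the limit of
    [rig_cdf b] at 0 when [b > 0]. *)
Lemma integral_itvoy_derivative (f F : R -> R) (l m : R) :
  (forall x : R, 0 < x -> 0 <= f x) ->
  (forall x : R, 0 < x -> {for x, continuous f}) ->
  (forall x : R, 0 < x -> is_derive x 1 F (f x)) ->
  F x @[x --> +oo] --> l -> F (k.+1%:R^-1) @[k --> \oo] --> m ->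
  (\int[mu]_(x in `]0%R, +oo[) (f x)%:E = (l - m)%:E)%E.
Proof.
move=> f0 cf dF Fl Fm.
have kgt0 k : 0 < k.+1%:R^-1 :> R by [].
have cfk k : {within `[k.+1%:R^-1, +oo[, continuous f}.
  apply: continuous_in_subspaceT => x; rewrite inE/= in_itv/= andbT => kx.
  by apply: cf; exact: lt_le_trans kx.
have Ek k : (\int[mu]_(x in `[(k.+1%:R^-1)%R, +oo[) (f x)%:E
    = l%:E - (F (k.+1%:R^-1)%R)%:E)%E.
  apply: ge0_continuous_FTC2y => //.
  - by move=> x kx; apply: f0; exact: lt_le_trans kx.
  - by move=> x kx; have [] := dF _ (lt_trans (kgt0 k) kx).
  - apply: cvg_at_right_filter; apply: differentiable_continuous.
    by apply/derivable1_diffP; have [] := dF _ (kgt0 k).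
  - move=> x; rewrite in_itv/= andbT => kx; rewrite derive1E.
    by have [_ ->] := dF _ (lt_trans (kgt0 k) kx).
rewrite itvoyEbigcup; under eq_bigcupr do rewrite add0r.
have cvgI : (\int[mu]_(x in `[(k.+1%:R^-1)%R, +oo[) (f x)%:E)%E @[k --> \oo] -->
    (\int[mu]_(x in \bigcup_k `[(k.+1%:R^-1)%R, +oo[%classic) (f x)%:E)%E.
  apply: ge0_nondecreasing_set_cvg_integral => //.
  - move=> m1 n1 mn; rewrite subsetEset; apply: subset_itvr; rewrite bnd_simp.
    by rewrite lef_pV2 ?posrE ?ltr0n// ler_nat ltnS.
  - by move=> k; apply/measurable_EFinP; exact: subspace_continuous_measurable_fun.
  - move=> k x /=; rewrite in_itv/= andbT lee_fin => kx; apply: f0.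
    exact: lt_le_trans kx.
move: cvgI; rewrite (eq_cvg _ _ Ek) => cvgI; apply: (cvg_unique _ cvgI) => //.
rewrite EFinB; apply: cvgeB => //; first exact: cvg_cst.
by apply: cvg_EFin => //; exact: nearW.
Qed.

End integral_by_antiderivative.

(** * Limits and derivative of the standard normal distribution function *)

Section standard_normal_cdf.
Context {R : realType}.
Notation mu := (@lebesgue_measure R).
Notation phi := (@normal_pdf R 0 1).

Definition stdnormal_cdf (x : R) : R := (\int[mu]_(t in `]-oo, x]) phi t)%R.
Notation Phi := stdnormal_cdf.

(** The identity, seen as a random variable under the normal law, has [Phi] as its distribution
    function, so the general limits at -oo and +oo apply. *)
Let idTR : measurableTypeR R -> R := idfun.

#[local] HB.instance Definition _ :=
  @isMeasurableFun.Build _ _ _ _ idTR (@measurable_id _ _ setT).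

Let P : probability (measurableTypeR R) R := normal_prob (0 : R) 1.
Let X : {RV P >-> R} := idTR.

Let stdnormal_cdfE (x : R) : (Phi x)%:E = cdf X x.
Proof.
rewrite /Phi /Rintegral fineK//; apply: integrable_fin_num => //.
apply: (integrableS measurableT) => //; exact: integrable_normal_pdf.
Qed.

Lemma cvg_stdnormal_cdfy : Phi x @[x --> +oo] --> (1 : R).
Proof. by have := cvg_cdfy1 X; rewrite -(eq_cvg _ _ stdnormal_cdfE) => /fine_cvg. Qed.

Lemma cvg_stdnormal_cdfNy : Phi x @[x --> -oo] --> (0 : R).
Proof. by have := cvg_cdfNy0 X; rewrite -(eq_cvg _ _ stdnormal_cdfE) => /fine_cvg. Qed.

Lemma is_derive_stdnormal_cdf (x : R) : is_derive x 1 Phi (phi x).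
Proof.
have [||||dF FE] := @continuous_FTC1 R phi -oo%O x (x + 1).
- by rewrite ltrDl.
- apply: (integrableS measurableT) => //; exact: integrable_normal_pdf.
- by rewrite ltNyr.
- by have := @continuous_normal_pdf R 0 1 (oner_neq0 R); exact.
by split => //; rewrite -derive1E.
Qed.

End standard_normal_cdf.

(** Writing 1 / x as x (x^2)^(-1) reduces to a real power of a nonnegative base; the factor x gives
    the default value 0 at 0. *)
Lemma measurable_invr {R : realType} : measurable_fun setT (@GRing.inv R).
Proof.
rewrite (_ : GRing.inv = fun x : R => x * (x ^+ 2) `^ (-1)).
  apply: measurable_funM => //.
  by apply: measurableT_comp (measurable_powR (-1)) _; exact: exprn_measurable.
apply/funext => x; rewrite powR_inv1 ?sqr_ge0//.
by have [->|x0] := eqVneq x 0; [rewrite invr0 mul0r|field].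
Qed.

(** * Normalization of the reciprocal inverse Gaussian law *)

Section reciprocal_inverse_gaussian.
Context {R : realType}.
Notation mu := (@lebesgue_measure R).
Notation Phi := (@stdnormal_cdf R).

(* reciprocal inverse Gaussian law, of density
   (2 pi l)^(-1/2) exp(- (l - b)^2 / (2 l)) *)
Definition rig_logpdf (b l : R) : R :=
  - (2^-1 * ln (2 * pi)) - 2^-1 * ln l - (2^-1 * l - b + b ^+ 2 / (2 * l)).

Definition rig_pdf (b l : R) : R := expR (rig_logpdf b l).

(* The reflected term cancels the part of the derivative of the first one that
   is proportional to b l^(-3/2). *)
Definition rig_cdf (b l : R) : R :=
  Phi (Num.sqrt l - b / Num.sqrt l)
  - expR (2 * b) * Phi (- (Num.sqrt l + b / Num.sqrt l)).

(** The exponent is a complete square: l / 2 - b + b^2 / (2 l) = (s - b / s)^2 / 2 with s = sqrt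
    l. *)
Lemma rig_pdfE (b l : R) : 0 < l ->
  rig_pdf b l = (Num.sqrt l)^-1 * normal_pdf 0 1 (Num.sqrt l - b / Num.sqrt l).
Proof.
move=> l0; have s0 : 0 < Num.sqrt l by rewrite sqrtr_gt0.
rewrite normal_pdfE ?oner_neq0// /normal_peak /normal_fun.
have half_ln (z : R) : 0 < z -> expR (- (2^-1 * ln z)) = (Num.sqrt z)^-1.
  move=> z0; rewrite expRN; congr (_^-1).
  rewrite -{1}(sqr_sqrtr (ltW z0)) expr2 lnM ?posrE ?sqrtr_gt0//.
  rewrite -mulr2n -(mulr_natl (ln _)) mulKf// lnK// posrE sqrtr_gt0//.
rewrite /rig_pdf /rig_logpdf 2!expRD !half_ln ?mulr_gt0 ?pi_gt0//.
rewrite [_ / Num.sqrt l]mulrC -mulrA; congr (_ * (_ * expR _)).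
  by rewrite expr1n mul1r mulr_natl.
rewrite subr0 expr1n -{1 2}(sqr_sqrtr (ltW l0)).
by field; rewrite gt_eqF.
Qed.

Lemma rig_pdf_gt0 (b l : R) : 0 < rig_pdf b l.
Proof. exact: expR_gt0. Qed.

(** From (s + b / s)^2 = (s - b / s)^2 + 4 b; this is the origin of the factor exp(2 b) in
    [rig_cdf]. *)
Lemma normal_pdf01_reflect (b s : R) : 0 < s ->
  expR (2 * b) * normal_pdf 0 1 (- (s + b / s)) = normal_pdf 0 1 (s - b / s).
Proof.
move=> s0; rewrite normal_pdfE ?oner_neq0// mulrCA; congr (_ * _).
rewrite /normal_fun -expRD; congr expR.
by rewrite !subr0 expr1n; field; rewrite gt_eqF.
Qed.

(** After reflection both terms carry the same normal density, with factors (1 + b / s^2) / (2 s)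
    and (1 - b / s^2) / (2 s), whose sum is 1 / s. *)
Lemma is_derive_rig_cdf (b l : R) : 0 < l ->
  is_derive l 1 (rig_cdf b) (rig_pdf b l).
Proof.
move=> l0; have s0 : 0 < Num.sqrt l by rewrite sqrtr_gt0.
have ds : is_derive l 1 Num.sqrt (2 * Num.sqrt l)^-1 by exact: is_derive1_sqrt.
have dv : is_derive l 1 (fun x => (Num.sqrt x)^-1)
    (- (Num.sqrt l) ^- 2 *: (2 * Num.sqrt l)^-1).
  by apply: is_deriveV; rewrite gt_eqF.
have d1 := is_deriveB ds (is_deriveZ b dv).
have d2 := is_deriveN (is_deriveD ds (is_deriveZ b dv)).
have D1 := is_derive1_comp (is_derive_stdnormal_cdf _) d1.
have D2 := is_derive1_comp (is_derive_stdnormal_cdf _) d2.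
apply: (is_derive_eq (is_deriveB D1 (is_deriveZ (expR (2 * b)) D2))).
pose s := Num.sqrt l; rewrite rig_pdfE//.
transitivity (normal_pdf 0 1 (s - b / s) *
    ((2 * s)^-1 - b * (- s ^- 2 * (2 * s)^-1)) -
  expR (2 * b) * (normal_pdf 0 1 (- (s + b / s)) *
    - ((2 * s)^-1 + b * (- s ^- 2 * (2 * s)^-1)))) => //.
rewrite [expR _ * _]mulrA normal_pdf01_reflect// -mulrBr mulrC; congr (_ * _).
have key (t : R) : t != 0 -> (2 * t)^-1 - b * (- t ^- 2 * (2 * t)^-1) -
    - ((2 * t)^-1 + b * (- t ^- 2 * (2 * t)^-1)) = t^-1 by move=> t0; field.
by apply: key; rewrite gt_eqF.
Qed.

Lemma measurable_rig_logpdf (b : R) : measurable_fun setT (rig_logpdf b).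
Proof.
have mln := @measurable_ln R.
apply: measurable_funB.
  by apply: measurable_funB => //; exact: measurable_funM.
apply: measurable_funD.
  by apply: measurable_funB => //; exact: measurable_funM.
apply: measurable_funM => //; apply: measurableT_comp; first exact: measurable_invr.
exact: measurable_funM.
Qed.

Lemma measurable_rig_pdf (b : R) : measurable_fun setT (rig_pdf b).
Proof. by apply: measurableT_comp => //; exact: measurable_rig_logpdf. Qed.

Lemma cvgy_sqrt : Num.sqrt x @[x --> +oo] --> (+oo : set_system R).
Proof.
apply/cvgryPge => A; near=> x.
rewrite (le_trans (ler_norm A))// -sqrtr_sqr ler_wsqrtr//.
Unshelve. all: by end_near. Qed.

Lemma continuous_rig_pdf (b l : R) : 0 < l -> {for l, continuous (rig_pdf b)}.
Proof.
move=> l0; apply: continuous_comp; last exact: continuous_expR.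
have cln : {for l, continuous (@ln R)} by exact: continuous_ln.
apply: cvgB; first by apply: cvgB; [exact: cvg_cst|apply: cvgMl_tmp].
apply: cvgD; first by apply: cvgB; [apply: cvgMl_tmp; exact: cvg_id|exact: cvg_cst].
apply: cvgMl_tmp; apply: cvgV; first by rewrite gt_eqF// mulr_gt0.
by apply: cvgMl_tmp; exact: cvg_id.
Qed.

(** [rig_cdf b] tends to 1 at +oo and to 0 at 0. The sign of [b] matters: for negative [b] the total
    mass would be exp(2 b). *)
Lemma integral_rig_pdf (b : R) : 0 <= b ->
  (\int[mu]_(l in `]0%R, +oo[) (rig_pdf b l)%:E = 1)%E.
Proof.
move=> b0; rewrite -[1%E]/((1:R)%:E) -(subr0 (1:R)).
apply: (integral_itvoy_derivative (F := rig_cdf b)).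
- by move=> x _; exact/ltW/rig_pdf_gt0.
- by move=> x; exact: continuous_rig_pdf.
- by move=> x; exact: is_derive_rig_cdf.
- suff : rig_cdf b x @[x --> +oo] --> (1 : R) - expR (2 * b) * 0.
    by rewrite mulr0 subr0.
  apply: cvgB; last apply: cvgMl_tmp => //.
    apply: (cvg_comp _ _ _ cvg_stdnormal_cdfy).
    apply/cvgryPge => A; near=> x.
    have x1 : 1 <= x by near: x; exact: nbhs_pinfty_ge.
    have s1 : 1 <= Num.sqrt x by rewrite -[leLHS]sqrtr1 ler_wsqrtr.
    have : A + b <= Num.sqrt x.
      by near: x; move/cvgryPge : cvgy_sqrt; exact.
    suff : b / Num.sqrt x <= b by lra.
    by rewrite ler_piMr// invf_le1// (lt_le_trans ltr01).
  apply: (cvg_comp _ _ _ cvg_stdnormal_cdfNy).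
  apply/cvgrNyPle => A; near=> x.
  have : - A <= Num.sqrt x by near: x; move/cvgryPge : cvgy_sqrt; exact.
  have : 0 <= b / Num.sqrt x by rewrite divr_ge0// sqrtr_ge0.
  lra.
have sh : (Num.sqrt k.+1%:R^-1 : R) @[k --> \oo] --> (0 : R).
  rewrite -(@sqrtr0 R); apply: continuous_cvg; first exact: sqrt_continuous.
  exact: cvg_harmonic.
(* For [b = 0] the two arguments of [Phi] tend to 0 and the terms cancel; for [b > 0] both tend to
   -oo, because b / sqrt l tends to +oo. *)
move: b0; rewrite le_eqVlt => /predU1P[<-|b0].
  have E k : Phi (Num.sqrt k.+1%:R^-1) - expR (2 * 0) * Phi (- Num.sqrt k.+1%:R^-1)
      = rig_cdf 0 k.+1%:R^-1.
    by rewrite /rig_cdf !mul0r subr0 addr0.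
  rewrite -(eq_cvg _ _ E) mulr0 expR0.
  have cPhi : {for 0, continuous Phi}.
    apply: differentiable_continuous; apply/derivable1_diffP.
    by have [] := is_derive_stdnormal_cdf (0 : R).
  suff : Phi (Num.sqrt k.+1%:R^-1) - 1 * Phi (- Num.sqrt k.+1%:R^-1)
      @[k --> \oo] --> Phi 0 - 1 * Phi (- 0) by rewrite oppr0 mul1r subrr.
  apply: cvgB; first by apply: continuous_cvg; [exact: cPhi|exact: sh].
  apply: cvgMl_tmp; apply: continuous_cvg; first by rewrite oppr0.
  exact: cvgN.
have s0 k : 0 < Num.sqrt k.+1%:R^-1 :> R by rewrite sqrtr_gt0.
have big A : \forall k \near \oo, A <= b / Num.sqrt k.+1%:R^-1.
  have [N _ HN] := nbhs_infty_ger ((A / b) ^+ 2); exists N => // k /= Nk.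
  rewrite sqrtrV// invrK mulrC -ler_pdivrMr//.
  rewrite (le_trans (ler_norm (A / b)))// -sqrtr_sqr ler_wsqrtr//.
  by apply: HN => /=; exact: leqW.
suff : rig_cdf b k.+1%:R^-1 @[k --> \oo] --> (0 : R) - expR (2 * b) * 0.
  by rewrite mulr0 subr0.
apply: cvgB; last apply: cvgMl_tmp => //.
  apply: (cvg_comp _ _ _ cvg_stdnormal_cdfNy).
  apply/cvgrNyPle => A; near=> k.
  have : 1 - A <= b / Num.sqrt k.+1%:R^-1 by near: k; exact: big.
  have : Num.sqrt k.+1%:R^-1 <= 1 :> R.
    by rewrite -[leRHS]sqrtr1 ler_wsqrtr// invf_le1// ler1n.
  lra.
apply: (cvg_comp _ _ _ cvg_stdnormal_cdfNy).
apply/cvgrNyPle => A; near=> k.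
have : - A <= b / Num.sqrt k.+1%:R^-1 by near: k; exact: big.
have := s0 k; lra.
Unshelve. all: by end_near. Qed.

End reciprocal_inverse_gaussian.

(** * Integrability of l, ln l and b^2 / l under this law *)

Section rig_moments.
Context {R : realType}.
Notation mu := (@lebesgue_measure R).

(** With r = l^(1/4), the bound |ln l| <= 4 (r + 1 / r) times the singularity l^(-1/2) is of order
    l^(-3/4) near 0, which is integrable; the same estimate with square roots would give 1 / l. *)
Let root4 (l : R) := Num.sqrt (Num.sqrt l).
(* the derivative of 4 atan (l^(1/4)) *)
Let dominant (l : R) := (root4 l) ^- 3 / (1 + root4 l ^+ 2).

Let root4_gt0 (l : R) : 0 < l -> 0 < root4 l.
Proof. by move=> l0; rewrite !sqrtr_gt0. Qed.

Let root4X4 (l : R) : 0 < l -> root4 l ^+ 4 = l.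
Proof.
by move=> l0; rewrite (exprM _ 2 2) !sqr_sqrtr ?sqrtr_ge0// ltW.
Qed.

Let is_derive_root4 (l : R) : 0 < l -> is_derive l 1 root4 ((4 * root4 l ^+ 3)^-1).
Proof.
move=> l0; have s0 : 0 < Num.sqrt l by rewrite sqrtr_gt0.
apply: (is_derive_eq (is_derive1_comp (is_derive1_sqrt s0) (is_derive1_sqrt l0))).
have r0 := root4_gt0 l0; rewrite -[Num.sqrt (Num.sqrt l)]/(root4 l).
have -> : Num.sqrt l = root4 l ^+ 2 by rewrite sqr_sqrtr// ltW.
by field; rewrite gt_eqF.
Qed.

Let dominant_ge0 (l : R) : 0 < l -> 0 <= dominant l.
Proof.
move=> l0; rewrite divr_ge0 ?addr_ge0 ?sqr_ge0// invr_ge0 exprn_ge0//.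
exact: sqrtr_ge0.
Qed.

Let integral_dominant : (\int[mu]_(l in `]0%R, +oo[) (dominant l)%:E < +oo)%E.
Proof.
have croot4 (l : R) : {for l, continuous root4}.
  by apply: continuous_comp; exact: sqrt_continuous.
suff -> : (\int[mu]_(l in `]0%R, +oo[) (dominant l)%:E =
    (4 * (pi / 2) - 4 * atan 0)%:E)%E by rewrite ltry.
apply: (integral_itvoy_derivative (F := fun l => 4 * atan (root4 l))).
- exact: dominant_ge0.
- move=> l l0; have r0 := root4_gt0 l0.
  have cX n : root4 x ^+ n @[x --> l] --> root4 l ^+ n.
    apply: (@continuous_cvg _ _ _ _ _ root4 (fun y => y ^+ n)); last exact: croot4.
    exact: exprn_continuous.
  apply: (@cvgM _ _ _ _ (fun x => root4 x ^- 3)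
    (fun x => (1 + root4 x ^+ 2)^-1)); apply: cvgV => //.
  - by rewrite gt_eqF// exprn_gt0.
  - by rewrite gt_eqF// addr_gt0// exprn_gt0.
  - by apply: cvgD => //; exact: cvg_cst.
- move=> l l0; have r0 := root4_gt0 l0.
  have := is_deriveZ 4 (is_derive1_comp (is_derive1_atan _) (is_derive_root4 l0)).
  move/is_derive_eq; apply; rewrite -[_ *: _]/(_ * _) /dominant.
  have r1 : 1 + root4 l ^+ 2 != 0 by rewrite gt_eqF// addr_gt0// exprn_gt0.
  by field; rewrite ?r1 gt_eqF.
- apply: cvgMl_tmp; apply: (@cvg_comp _ _ _ root4 atan _ _ _ _ (@cvgy_atan R)).
  exact: (cvg_comp _ _ cvgy_sqrt cvgy_sqrt).
- apply: cvgMl_tmp; apply: continuous_cvg; first exact: continuous_atan.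
  have <- : root4 0 = 0 by rewrite /root4 !sqrtr0.
  apply: continuous_cvg; first exact: croot4.
  exact: cvg_harmonic.
Qed.

(** The polynomial is (r^4 + 4 (r + 1 / r)) r^(-2) divided by [dominant]. Bounding each power by 1 +
    r^8 gives at most 18 (1 + r^8), while the exponential is at least 1 + r^8 / 8; hence 144 = 8 *
    18. *)
Let poly_le_expR (r : R) : 0 <= r ->
  (r ^+ 5 + 4 * r ^+ 2 + 4) * (1 + r ^+ 2) <= 144 * expR (r ^+ 4 / 2).
Proof.
move=> r0; have e := @expR_ge1Dxn R (r ^+ 4 / 2) 1 _.
have {}e : 1 + (r ^+ 4 / 2) ^+ 2 / 2 <= expR (r ^+ 4 / 2).
  by apply: e; rewrite divr_ge0// exprn_ge0.
have h n : (n <= 8)%N -> r ^+ n <= 1 + r ^+ 8.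
  move=> n8; have [r1|r1] := leP r 1.
    by rewrite (@le_trans _ _ 1) ?exprn_ile1// lerDl exprn_ge0.
  by rewrite (@le_trans _ _ (r ^+ 8)) ?lerDr// ler_weXn2l// ltW.
have -> : (r ^+ 5 + 4 * r ^+ 2 + 4) * (1 + r ^+ 2) =
  r ^+ 5 + r ^+ 7 + 4 * r ^+ 4 + 8 * r ^+ 2 + 4 by ring.
have e8 : (r ^+ 4 / 2) ^+ 2 / 2 = r ^+ 8 / 8 by field.
rewrite e8 in e.
have := h 5 isT; have := h 7 isT; have := h 4 isT; have := h 2 isT.
have : 0 <= r ^+ 8 by rewrite exprn_ge0.
move: e; move: (r ^+ 8) (r ^+ 7) (r ^+ 5) (r ^+ 2) (r ^+ 4) => a1 a2 a3 a4 a5.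
move: (expR _) => E; lra.
Qed.

(** A single weight that dominates [ln l] and, up to the constant [|a|], [quadratic_term a b l]. *)
Definition rig_weight (b l : R) := l + `|ln l| + b ^+ 2 / l.

Lemma rig_weight_ge0 (b l : R) : 0 < l -> 0 <= rig_weight b l.
Proof.
by move=> l0; rewrite !addr_ge0 ?divr_ge0 ?sqr_ge0 ?normr_ge0 ?(ltW l0).
Qed.

Lemma measurable_rig_weight (b : R) : measurable_fun setT (rig_weight b).
Proof.
apply: measurable_funD; last first.
  by apply: measurable_funM => //; exact: measurable_invr.
apply: measurable_funD => //.
by apply: measurableT_comp => //; exact: measurable_ln.
Qed.

Lemma rig_weight_le (b l : R) : 0 < l ->
  rig_weight b l * rig_pdf b l <= expR b * (144 * dominant l + 2 * rig_pdf 0 l).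
Proof.
move=> l0; have r0 := root4_gt0 l0; pose r := root4 l.
rewrite -/r in r0.
have lE : l = r ^+ 4 by rewrite root4X4.
have pdf_le : rig_pdf b l <= expR b * rig_pdf 0 l.
  rewrite -expRD ler_expR /rig_logpdf.
  suff : 0 <= b ^+ 2 / (2 * l) by rewrite expr0n/= mul0r; lra.
  by rewrite divr_ge0 ?sqr_ge0// mulr_ge0// ltW.
(* Here r^(-2) is l^(-1/2), and the factor (2 pi)^(-1/2) <= 1 is dropped. *)
have pdf0_le : rig_pdf 0 l <= r ^- 2 * expR (- (r ^+ 4 / 2)).
  rewrite -(lnK (_ : r ^- 2 \is Num.pos)) ?posrE ?invr_gt0 ?exprn_gt0//.
  rewrite -expRD ler_expR /rig_logpdf.
  rewrite lnV ?posrE ?exprn_gt0// lnXn// [in ln l]lE lnXn//.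
  have : 0 <= ln (2 * pi : R).
    apply: ln_ge0; have := @pi_ge2 R; lra.
  rewrite expr0n/= mul0r -lE -[ln r *+ 2]mulr_natl -[ln r *+ 4]mulr_natl; lra.
have ln_abs : `|ln l| <= 4 * (r + r^-1).
  rewrite lE lnXn// -[ln r *+ 4]mulr_natl normrM normr_nat ler_pM2l//.
  have := ln_sublinear r0; have r0' : 0 < r^-1 by rewrite invr_gt0.
  have := ln_sublinear r0'; rewrite lnV ?posrE// ler_norml -/r => h1 h2.
  by apply/andP; split; lra.
rewrite mulrDl mulrDr lerD//.
  apply: (@le_trans _ _ ((r ^+ 4 + 4 * (r + r^-1)) *
     (expR b * (r ^- 2 * expR (- (r ^+ 4 / 2)))))).
    apply: ler_pM => //; rewrite ?addr_ge0 ?(ltW l0) ?expR_ge0//.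
      by rewrite lerD// lE.
    by rewrite (le_trans pdf_le)// ler_pM2l ?expR_gt0.
  rewrite mulrCA ler_pM2l ?expR_gt0//.
  have -> : (r ^+ 4 + 4 * (r + r^-1)) * (r ^- 2 * expR (- (r ^+ 4 / 2))) =
    dominant l * ((r ^+ 5 + 4 * r ^+ 2 + 4) * (1 + r ^+ 2) / expR (r ^+ 4 / 2)).
    rewrite expRN /dominant -/r; field.
    by rewrite !gt_eqF ?expR_gt0// addr_gt0 ?exprn_gt0.
  rewrite [leRHS]mulrC; apply: ler_wpM2l.
    by rewrite divr_ge0 ?addr_ge0 ?sqr_ge0// invr_ge0 exprn_ge0// ltW.
  by rewrite ler_pdivrMr ?expR_gt0//; apply: poly_le_expR; exact: ltW.
(* 1 / l is not integrable against [rig_pdf 0], so the factor exp(- y) of [rig_pdf b], with y = b^2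
   / (2 l), has to be kept: b^2 / l = 2 y, and y exp(- y) <= 1. *)
have y0 : 0 <= b ^+ 2 / (2 * l) by rewrite divr_ge0 ?sqr_ge0// mulr_ge0// ltW.
have -> : b ^+ 2 / l * rig_pdf b l =
    expR b * (2 * rig_pdf 0 l) * (b ^+ 2 / (2 * l) / expR (b ^+ 2 / (2 * l))).
  have -> : rig_pdf b l = expR b * rig_pdf 0 l / expR (b ^+ 2 / (2 * l)).
    by rewrite -expRD -expRN -expRD; congr expR; rewrite /rig_logpdf expr0n/=; ring.
  have l1 : l != 0 by rewrite gt_eqF.
  have e1 : expR (b ^+ 2 / (2 * l)) != 0 by rewrite gt_eqF// expR_gt0.
  by field; rewrite ?l1 ?e1.
rewrite ler_piMr ?mulr_ge0 ?expR_ge0// ler_pdivrMr ?expR_gt0// mul1r.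
by apply: le_trans (expR_ge1Dx _); rewrite lerDr.
Qed.

Lemma integral_rig_weight_lty (b : R) :
  (\int[mu]_(l in `]0%R, +oo[) (rig_weight b l * rig_pdf b l)%:E < +oo)%E.
Proof.
have mdom : measurable_fun setT dominant.
  have mr n : measurable_fun setT (fun l : R => root4 l ^+ n).
    have ms : measurable_fun setT (@Num.sqrt R).
      by apply: continuous_measurable_fun; exact: sqrt_continuous.
    by apply: measurable_funX; exact: measurableT_comp.
  apply: measurable_funM; apply: measurableT_comp (@measurable_invr R) _ => //.
  exact: measurable_funD.
have mD : measurable_fun (`]0%R, +oo[ : set R) (EFin \o dominant).
  exact/measurable_EFinP/measurable_funTS.
have mP : measurable_fun (`]0%R, +oo[ : set R) (EFin \o rig_pdf 0).
  by apply/measurable_EFinP/measurable_funTS; exact: measurable_rig_pdf.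
have mW := measurable_rig_weight b.
apply: (@le_lt_trans _ _ (\int[mu]_(l in `]0%R, +oo[)
   ((expR b * 144)%:E * (dominant l)%:E + (expR b * 2)%:E * (rig_pdf 0 l)%:E))%E).
  apply: ge0_le_integral => //.
  - move=> l /=; rewrite in_itv/= andbT lee_fin => l0.
    by rewrite mulr_ge0 ?expR_ge0// rig_weight_ge0.
  - apply/measurable_EFinP/measurable_funTS/measurable_funM => //.
    exact: measurable_rig_pdf.
  - by apply: emeasurable_funD; exact: measurable_funeM.
  - move=> l /=; rewrite in_itv/= andbT => l0.
    rewrite -!EFinM -EFinD lee_fin -!mulrA -mulrDr.
    exact: rig_weight_le.
rewrite ge0_integralD//=; first last.
- exact: measurable_funeM.
- by move=> l _; rewrite -EFinM lee_fin !mulr_ge0 ?expR_ge0.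
- exact: measurable_funeM.
- move=> l /=; rewrite in_itv/= andbT => l0; rewrite -EFinM lee_fin.
  by apply: mulr_ge0; [rewrite mulr_ge0 ?expR_ge0|exact: dominant_ge0].
rewrite !ge0_integralZl_EFin//=; rewrite ?mulr_ge0 ?expR_ge0 //.
- rewrite integral_rig_pdf// mule1.
  have : (0 <= \int[mu]_(l in `]0%R, +oo[) (dominant l)%:E)%E.
    apply: integral_ge0 => l /=; rewrite in_itv/= andbT => l0.
    by rewrite lee_fin dominant_ge0.
  case: (\int[mu]_(l in _) _)%E integral_dominant => // r _ _.
  by rewrite -EFinM -EFinD ltry.
- by move=> l _; rewrite lee_fin expR_ge0.
- move=> l /=; rewrite in_itv/= andbT => l0; rewrite lee_fin; exact: dominant_ge0.
Qed.

End rig_moments.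

(** * Integrals of products over tuples and over the positive orthant *)

Section tuple_tonelli.
Context {R : realType}.
Notation mu := (@lebesgue_measure R).

Lemma lebesgue_tuple_integral_prod (n : nat) (f : 'I_n -> R -> R) :
  (forall i, measurable_fun setT (f i)) -> (forall i x, 0 <= f i x) ->
  (\int[lebesgue_tuple n]_t (\prod_(i < n) f i (tnth t i))%:E =
   \prod_(i < n) \int[mu]_x (f i x)%:E)%E.
Proof.
elim: n f => [|n IH] f mf f0.
  rewrite big_ord0; under eq_integral do rewrite big_ord0.
  rewrite integral_cst// mul1e /=.
  exact: diracT.
rewrite [RHS]big_ord_recl -IH//.
have mprod k (g : 'I_k -> R -> R) : (forall i, measurable_fun setT (g i)) ->
    measurable_fun [set: k.-tuple R] (fun t => \prod_(i < k) g i (tnth t i)).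
  move=> mg; apply: measurable_prod => i _.
  by apply: measurableT_comp => //; exact: measurable_tnth.
have prod0 k (g : 'I_k -> R -> R) (t : k.-tuple R) : (forall i x, 0 <= g i x) ->
    0 <= \prod_(i < k) g i (tnth t i) by move=> g0; exact: prodr_ge0.
have mcons : measurable_fun [set: measurableTypeR R * n.-tuple R]
  (@cons_pair R n) := @measurable_cons_pair R n.
pose F (t : n.+1.-tuple R) : \bar R := (\prod_(i < n.+1) f i (tnth t i))%:E.
have mF : measurable_fun setT F by apply/measurable_EFinP; exact: mprod.
have F0 : {in setT, forall t, 0 <= F t}%E by move=> t _; rewrite lee_fin prod0.
(* The measure on tuples of length n + 1 is by definition this pushforward, so Tonelli splits off
   the first coordinate. *)
rewrite -[LHS]/(\int[pushforward (mu \x lebesgue_tuple n) (@cons_pair R n)]_t F t)%E.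
rewrite (ge0_integral_pushforward mcons (mu \x lebesgue_tuple n)%E measurableT mF F0).
rewrite preimage_setT fubini_tonelli1//; last 2 first.
- exact: measurableT_comp mF mcons.
- by move=> z; rewrite lee_fin prod0.
transitivity (\int[mu]_x ((f ord0 x)%:E *
    \int[lebesgue_tuple n]_t (\prod_(i < n) f (lift ord0 i) (tnth t i))%:E))%E.
  apply: eq_integral => x _; rewrite /fubini_F -ge0_integralZl//; last 3 first.
  - by apply/measurable_EFinP; exact: (mprod n (fun i => f (lift ord0 i))).
  - move=> t _; rewrite lee_fin; exact: (prod0 n (fun i => f (lift ord0 i))).
  - by rewrite lee_fin.
  apply: eq_integral => t _; rewrite -EFinM; congr EFin.
  rewrite [LHS]big_ord_recl; congr (_ * _).
  by apply: eq_bigr => i _; rewrite tnthS.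
rewrite ge0_integralZr//.
- apply/measurable_EFinP; exact: (mf ord0).
- by move=> x _; rewrite lee_fin.
- apply: integral_ge0 => t _; rewrite lee_fin.
  exact: (prod0 n (fun i => f (lift ord0 i))).
Qed.

Lemma measurable_positive_orthant n : measurable (@positive_orthant R n).
Proof.
rewrite (_ : @positive_orthant R n = \bigcap_(i in setT)
    (fun t : n.-tuple R => tnth t i) @^-1` `]0, +oo[).
  apply: fin_bigcap_measurable => // i _.
  by rewrite -[X in measurable X]setTI; exact: measurable_tnth.
apply/seteqP; split => [t t0 i _|t t0 i] /=; first by rewrite in_itv/= andbT.
by have := t0 i Logic.I; rewrite /= in_itv/= andbT.
Qed.

(** The restriction to the orthant is absorbed as an indicator in each factor, which also makes the
    factors nonnegative everywhere. *)
Lemma orthant_integral_prod (n : nat) (f : 'I_n -> R -> R) :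
  (forall i, measurable_fun setT (f i)) -> (forall i x, 0 < x -> 0 <= f i x) ->
  (\int[lebesgue_tuple n]_(t in @positive_orthant R n)
     (\prod_(i < n) f i (tnth t i))%:E =
   \prod_(i < n) \int[mu]_(x in `]0%R, +oo[) (f i x)%:E)%E.
Proof.
move=> mf f0; pose D : set R := `]0, +oo[%classic.
have DE x : D x = (0 < x) :> Prop by rewrite /D /= in_itv/= andbT.
transitivity (\prod_(i < n) \int[mu]_x (f i x * \1_D x)%:E)%E; last first.
  apply: eq_bigr => i _; rewrite [RHS]integral_mkcond; apply: eq_integral => x _.
  rewrite patchE -/D indicE; case: ifPn => xD; first by rewrite mulr1.
  by rewrite mulr0.
rewrite -lebesgue_tuple_integral_prod; last 2 first.
- by move=> i; apply: measurable_funM => //; apply: measurable_indic; exact: measurable_itv.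
- move=> i x; rewrite indicE; case: (boolP (x \in D)) => [|_]; last by rewrite mulr0.
  by rewrite inE DE mulr1; exact: f0.
rewrite integral_mkcond; apply: eq_integral => t _; rewrite patchE.
case: ifPn => [|/negP tD].
  rewrite inE => t0; congr EFin; apply: eq_bigr => i _.
  by rewrite indicE mem_set ?mulr1// DE.
have [i /negP ti] : exists i, ~~ (0 < tnth t i).
  apply/not_existsP => h; apply: tD; rewrite inE => i; apply/negPn/negP => hi.
  exact: (h i).
rewrite (bigD1 i)//= indicE memNset ?mulr0 ?mul0r//.
by rewrite DE.
Qed.

End tuple_tonelli.

(** * Integrability criteria *)

Section integrable_extra.
Context d (T : measurableType d) (R : realType) (mu : {measure set T -> \bar R}).
Context (D : set T) (mD : measurable D).
Local Open Scope ereal_scope.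

Lemma integrable_of_funeposneg (f : T -> \bar R) : measurable_fun D f ->
  \int[mu]_(x in D) f^\+ x < +oo -> \int[mu]_(x in D) f^\- x < +oo ->
  mu.-integrable D f.
Proof.
move=> mf fp fn; apply/integrableP; split => //.
under eq_integral do rewrite -/((abse \o f) _) fune_abse.
rewrite ge0_integralD//; first exact: lte_add_pinfty.
  exact: measurable_funepos.
exact: measurable_funeneg.
Qed.

(** The integral is the difference of those of the positive and negative parts, and +oo - oo is -oo;
    a finite value therefore forces both to be finite. *)
Lemma integrable_of_fin_num (f : T -> \bar R) : measurable_fun D f ->
  \int[mu]_(x in D) f x \is a fin_num -> mu.-integrable D f.
Proof.
move=> mf; rewrite integralE => fin.
have : 0 <= \int[mu]_(x in D) f^\+ x by exact: integral_ge0.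
have : 0 <= \int[mu]_(x in D) f^\- x by exact: integral_ge0.
move: fin; case Ep : (\int[mu]_(x in D) f^\+ x) => [a||] //;
  case En : (\int[mu]_(x in D) f^\- x) => [b||] // _ _ _.
by apply: integrable_of_funeposneg => //; rewrite ?Ep ?En ltry.
Qed.

(** The integrable minorant makes the negative part of [f] integrable, so only the positive part can
    be infinite. *)
Lemma integrable_or_integral_pinfty (f h : T -> \bar R) :
  measurable_fun D f -> mu.-integrable D h -> (forall x, D x -> h x <= f x) ->
  mu.-integrable D f \/ \int[mu]_(x in D) f x = +oo.
Proof.
move=> mf ih hf.
have fn : \int[mu]_(x in D) f^\- x < +oo.
  apply: le_lt_trans (integral_funeneg_lt_pinfty mD ih).
  apply: ge0_le_integral => //.
  - exact: measurable_funeneg.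
  - by apply: measurable_funeneg; exact: measurable_int ih.
  - move=> x Dx; rewrite !funenegE.
    by apply: comparable_le_max2 => //; rewrite leeN2; exact: hf.
have [fpy|fp] := eqVneq (\int[mu]_(x in D) f^\+ x) +oo; last first.
  by left; apply: integrable_of_funeposneg => //; rewrite ltey.
right; rewrite integralE fpy addye//; case: (\int[mu]_(x in D) _) fn => //.
Qed.

Let integrableR (f : T -> R) := mu.-integrable D (EFin \o f).

Lemma integrableR_D (f g : T -> R) : integrableR f -> integrableR g ->
  integrableR (fun x => (f x + g x)%R).
Proof. by move=> fi gi; exact: (integrableD mD fi gi). Qed.

Lemma integrableR_Z (k : R) (f : T -> R) : integrableR f ->
  integrableR (fun x => (k * f x)%R).
Proof. by move=> fi; exact: (integrableZl mD k fi). Qed.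

Lemma integrableR_sum (I : finType) (f : I -> T -> R) :
  (forall i, integrableR (f i)) -> integrableR (fun x => (\sum_i f i x)%R).
Proof.
move=> fi; have := @integrable_sum _ _ _ mu D mD I (index_enum I) xpredT
  (fun i => EFin \o f i) (fun i _ => fi i).
by apply: eq_integrable => // x _; rewrite /= -sumEFin.
Qed.

Lemma integrableR_le (f g : T -> R) : measurable_fun D f -> integrableR g ->
  (forall x, D x -> (`|f x| <= g x)%R) -> integrableR f.
Proof.
move=> mf gi fg; apply: le_integrable gi => //; first exact/measurable_EFinP.
by move=> x Dx /=; rewrite lee_fin (le_trans (fg _ Dx))// ler_norm.
Qed.

Lemma Rintegral_sum (I : finType) (f : I -> T -> R) :
  (forall i, integrableR (f i)) ->
  (\int[mu]_(x in D) (\sum_i f i x) = \sum_i \int[mu]_(x in D) f i x)%R.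
Proof.
move=> fi; rewrite /Rintegral; under eq_integral do rewrite -sumEFin.
rewrite (@integral_sum _ _ _ mu D mD I (fun i => EFin \o f i) fi) -sum_fine//.
by move=> i _; exact: (integrable_fin_num mD (fi i)).
Qed.

End integrable_extra.

Import DualAddTheory.

(** * Gibbs' inequality for the objective, with its equality case *)

Section gibbs.
Context {R : realType}.

(** The inequality 1 + x <= exp x at x = L - ln q, multiplied by q. Between densities the terms q
    and exp L have equal integrals, so it integrates to Gibbs' inequality. *)
Lemma gibbs_pointwise (q L : R) : 0 <= q -> q * L + q - expR L <= ln q * q.
Proof.
rewrite le_eqVlt => /predU1P[<-|q0].
  by rewrite !mul0r mulr0 add0r sub0r oppr_le0 expR_ge0.
have := @expR_ge1Dx R (L - ln q); rewrite expRB lnK ?posrE// ler_pdivlMr//.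
by rewrite mulrDl mulrBl mul1r; lra.
Qed.

Context {N : nat}.
Notation mu := (@lebesgue_tuple R N).
Notation D := (@positive_orthant R N).
Implicit Types (a b : 'I_N -> R) (q : N.-tuple R -> R) (l : N.-tuple R).

Definition prod_rig_logpdf b l := \sum_n rig_logpdf (b n) (tnth l n).

Definition prod_rig_pdf b l := expR (prod_rig_logpdf b l).

Lemma prod_rig_pdfE b l : prod_rig_pdf b l = \prod_n rig_pdf (b n) (tnth l n).
Proof. by rewrite /prod_rig_pdf expR_sum. Qed.

Let mD : measurable D. Proof. exact: measurable_positive_orthant. Qed.

Lemma measurable_fun_coord (f : R -> R) (n : 'I_N) : measurable_fun setT f ->
  measurable_fun setT (fun l : N.-tuple R => f (tnth l n)).
Proof. by move=> mf; apply: measurableT_comp mf _; exact: measurable_tnth. Qed.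

Lemma measurable_prod_rig_logpdf b : measurable_fun setT (prod_rig_logpdf b).
Proof.
apply: measurable_sum => n; apply: measurable_fun_coord.
exact: measurable_rig_logpdf.
Qed.

Lemma measurable_prod_rig_pdf b : measurable_fun setT (prod_rig_pdf b).
Proof. by apply: measurableT_comp => //; exact: measurable_prod_rig_logpdf. Qed.

Lemma is_density_prod_rig_pdf b : (forall n, 0 <= b n) ->
  is_density (prod_rig_pdf b).
Proof.
move=> b0; split.
- by apply: measurable_funTS; exact: measurable_prod_rig_pdf.
- by move=> l _; exact: expR_ge0.
under eq_integral do rewrite prod_rig_pdfE.
rewrite (@orthant_integral_prod R N (fun n => rig_pdf (b n))).
- by apply: big1 => n _; exact: integral_rig_pdf.
- by move=> n; exact: measurable_rig_pdf.
- by move=> n x _; exact: expR_ge0.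
Qed.

(* [(l^2 + 2 a l + b^2) / (2 l)], the second-moment term of the bound when
   [c zeta] has mean [a] and second moment [b^2] *)
Definition quadratic_term (a b l : R) := l / 2 + a + b ^+ 2 / (2 * l).

Lemma measurable_quadratic_term (a b : R) :
  measurable_fun setT (quadratic_term a b).
Proof.
apply: measurable_funD.
  by apply: measurable_funD => //; exact: measurable_funM.
apply: measurable_funM => //; apply: measurableT_comp.
  exact: measurable_invr.
exact: measurable_funM.
Qed.

Definition log_const : R := N%:R * (2^-1 * ln (2 * pi)).

Definition gibbs_objective a b q : \bar R :=
  (- entropy q
   + \sum_(n < N)
       ((2^-1)%:E * qexpectation q (fun l => (ln (tnth l n))%:E)
        + qexpectation q (fun l => (quadratic_term (a n) (b n) (tnth l n))%:E))
   + log_const%:E)%dE.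

Let I (f : N.-tuple R -> R) := mu.-integrable D (EFin \o f).

Let qexpectationE q (f : N.-tuple R -> R) : I (fun l => f l * q l) ->
  qexpectation q (fun l => (f l)%:E) = (\int[mu]_(l in D) (f l * q l))%:E.
Proof. by move=> fi; rewrite /Rintegral fineK//; exact: (integrable_fin_num mD fi). Qed.

Let integrand a b q l := ln (q l) * q l
  + \sum_(n < N) (2^-1 * (ln (tnth l n) * q l)
                  + quadratic_term (a n) (b n) (tnth l n) * q l)
  + log_const * q l.

(** In each coordinate, [quadratic_term] plus (ln l) / 2 is a + b minus [rig_logpdf] minus (ln (2
    pi)) / 2; the objective is thus a relative entropy plus the sum of the a + b. *)
Let integrandE a b q l : integrand a b q l =
  ln (q l) * q l - q l * prod_rig_logpdf b l + (\sum_n (a n + b n)) * q l.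
Proof.
rewrite /integrand; have -> : log_const * q l = \sum_(n < N) 2^-1 * ln (2 * pi) * q l.
  by rewrite sumr_const card_ord /log_const -[RHS]mulr_natl !mulrA.
rewrite -!addrA; congr (_ + _).
rewrite mulr_sumr mulr_suml -sumrN -!big_split/=; apply: eq_bigr => n _.
by rewrite /quadratic_term /rig_logpdf; ring.
Qed.

Lemma gibbs_objectiveE a b q : is_density q ->
  I (fun l => ln (q l) * q l) ->
  (forall n, I (fun l => ln (tnth l n) * q l)) ->
  (forall n, I (fun l => quadratic_term (a n) (b n) (tnth l n) * q l)) ->
  I (integrand a b q) /\
  gibbs_objective a b q = (\int[mu]_(l in D) integrand a b q l)%:E.
Proof.
move=> [mq q0 q1] iu iv isq.
have iq : I q.
  apply: (integrable_of_fin_num mD); first exact/measurable_EFinP.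
  by rewrite q1.
have ivs n : I (fun l => 2^-1 * (ln (tnth l n) * q l)
    + quadratic_term (a n) (b n) (tnth l n) * q l).
  exact: (integrableR_D mD (integrableR_Z mD 2^-1 (iv n)) (isq n)).
have iS := integrableR_sum mD ivs.
have iuS := integrableR_D mD iu iS.
have ic := integrableR_Z mD log_const iq.
split; first exact: (integrableR_D mD iuS ic).
have q1' : \int[mu]_(l in D) q l = 1 by rewrite /Rintegral q1.
rewrite /gibbs_objective /entropy oppeK qexpectationE//.
rewrite /integrand (RintegralD mD iuS ic) (RintegralD mD iu iS).
rewrite (Rintegral_sum mD ivs) (RintegralZl _ mD iq) q1' mulr1.
rewrite !dEFinD -dsumEFin; congr (_ + _ + _)%dE; apply: eq_bigr => n _.
rewrite (RintegralD mD (integrableR_Z mD 2^-1 (iv n)) (isq n)).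
by rewrite (RintegralZl _ mD (iv n)) !qexpectationE.
Qed.

Lemma gibbs_objective_ge a b q : (forall n, `|a n| <= b n) -> is_density q ->
  ((\sum_n (a n + b n))%:E <= gibbs_objective a b q)%E.
Proof.
move=> ab dq; have [mq q0 q1] := dq.
have b0 n : 0 <= b n := le_trans (normr_ge0 _) (ab n).
have iq : I q.
  by apply: (integrable_of_fin_num mD); [exact/measurable_EFinP|rewrite q1].
have ig b' : (forall n, 0 <= b' n) -> I (prod_rig_pdf b').
  move=> b'0; have [mg _ g1] := is_density_prod_rig_pdf b'0.
  by apply: (integrable_of_fin_num mD); [exact/measurable_EFinP|rewrite g1].
have mcoord (f : R -> R) n : measurable_fun setT f ->
    measurable_fun D (fun l => f (tnth l n) * q l).
  move=> mf; apply: measurable_funM => //; apply: measurable_funTS.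
  exact: measurable_fun_coord.
pose s n l := quadratic_term (a n) (b n) (tnth l n) * q l.
pose u l := ln (q l) * q l.
pose v n l := ln (tnth l n) * q l.
have ms n : measurable_fun D (s n).
  by apply: mcoord; exact: measurable_quadratic_term.
have mv n : measurable_fun D (v n) by apply: mcoord; exact: measurable_ln.
have mu_ : measurable_fun D u.
  by apply: measurable_funM => //; apply: measurableT_comp => //; exact: measurable_ln.
have s_ge n l : D l -> (tnth l n / 2 + a n) * q l <= s n l.
  move=> Dl; apply: ler_wpM2r; first exact: q0.
  by rewrite lerDl divr_ge0 ?sqr_ge0// mulr_ge0// ltW// Dl.
have s0 n l : D l -> 0 <= s n l.
  move=> Dl; have l0 := Dl n; apply: mulr_ge0; last exact: q0.
  (* Completing the square: b^2 - a^2, which plays the part of a variance, is nonnegative. *)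
  have -> : quadratic_term (a n) (b n) (tnth l n) =
      ((tnth l n + a n) ^+ 2 + (b n ^+ 2 - a n ^+ 2)) / (2 * tnth l n).
    by rewrite /quadratic_term; field; rewrite gt_eqF.
  apply: divr_ge0; last by rewrite mulr_ge0// ltW.
  apply: addr_ge0; first exact: sqr_ge0.
  by rewrite subr_ge0 -(real_normK (num_real (a n))) ler_sqr ?nnegrE ?normr_ge0.
(* If one quadratic term has infinite integral, dual addition makes the whole objective +oo,
   whatever the other terms are. *)
have [[n sn]|sfin] := pselect (exists n,
    (\int[mu]_(l in D) (s n l)%:E)%E = +oo%E).
  rewrite [leRHS](_ : _ = +oo%E) ?leey//.
  apply/eqP; rewrite /gibbs_objective !dadde_eq_pinfty; apply/orP; left.
  apply/orP; right; rewrite (bigD1 n)//= dadde_eq_pinfty; apply/orP; left.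
  by rewrite dadde_eq_pinfty /qexpectation sn eqxx orbT.
have is_ n : I (s n).
  apply: (integrable_of_fin_num mD); first exact/measurable_EFinP.
  rewrite ge0_fin_numE; last by apply: integral_ge0 => l Dl; rewrite lee_fin s0.
  by rewrite ltey; apply/eqP => sn; apply: sfin; exists n.
(* Since l / 2 + a is at most the quadratic term, l <= 2 [quadratic_term] + 2 |a|. *)
have il n : I (fun l => tnth l n * q l).
  apply: (integrableR_le mD (mcoord id n _)) (integrableR_D mD
    (integrableR_Z mD 2 (is_ n)) (integrableR_Z mD (2 * `|a n|) iq)) _ => //.
  move=> l Dl /=; have := s_ge n l Dl; rewrite ger0_norm ?mulr_ge0 ?q0 ?(ltW (Dl n))//.
  have : - a n * q l <= `|a n| * q l by rewrite ler_wpM2r ?q0// -normrN ler_norm.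
  by rewrite !mulrDl; lra.
pose Lam l := \sum_n tnth l n * q l.
have iLam : I Lam by exact: (integrableR_sum mD il).
pose g0 := prod_rig_pdf (fun=> 0).
have ig0 : I g0 by exact: ig.
(* Gibbs' inequality against the laws with b = 0 bounds [ln q * q] from below
   by the integrable [h]: its integral is not -oo, and when it is finite so is
   that of every [v n]. *)
pose h l := (1 - log_const) * q l + (-1) * Lam l + (-1) * g0 l.
have ih : I h.
  exact: (integrableR_D mD (integrableR_D mD (integrableR_Z mD _ iq)
    (integrableR_Z mD _ iLam)) (integrableR_Z mD _ ig0)).
have lq0 n l : D l -> 0 <= tnth l n * q l.
  by move=> Dl; rewrite mulr_ge0 ?q0// ltW.
have v_le n l : D l -> v n l <= tnth l n * q l.
  by move=> Dl; rewrite ler_wpM2r ?q0// ltW// ln_sublinear// Dl.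
have v_Lam l : D l -> \sum_n v n l <= Lam l.
  by move=> Dl; apply: ler_sum => n _; exact: v_le.
have Lam_ge n l : D l -> tnth l n * q l <= Lam l.
  by move=> Dl; rewrite /Lam (bigD1 n)//= lerDl sumr_ge0// => m _; exact: lq0.
(* In the log-density at b = 0, - l / 2 - (ln l) / 2 is split as - l + (l - ln l) / 2; the last part
   is nonnegative and is left out of [h]. *)
have u_ge l : D l -> h l + 2^-1 * (Lam l - \sum_n v n l) <= u l.
  move=> Dl; apply: le_trans (gibbs_pointwise (prod_rig_logpdf (fun=> 0) l) (q0 l Dl)).
  rewrite -[expR _]/(g0 l) /h.
  suff -> : q l * prod_rig_logpdf (fun=> 0) l =
      - (log_const * q l) - 2^-1 * (\sum_n v n l) - 2^-1 * Lam l by lra.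
  have -> : log_const * q l = \sum_(n < N) 2^-1 * ln (2 * pi) * q l.
    by rewrite sumr_const card_ord /log_const -[RHS]mulr_natl !mulrA.
  rewrite /Lam !mulr_sumr -!sumrN -!big_split/=; apply: eq_bigr => n _.
  by rewrite /v /rig_logpdf expr0n/= mul0r; ring.
have hu l : D l -> h l <= u l.
  by move=> Dl; apply: le_trans (u_ge l Dl); rewrite lerDl mulr_ge0// subr_ge0 v_Lam.
have mu_E : measurable_fun D (EFin \o u) by exact/measurable_EFinP.
have [iu|uy] := integrable_or_integral_pinfty mD mu_E ih
    (fun l Dl => hu l Dl : ((h l)%:E <= (u l)%:E)%E); last first.
  rewrite [leRHS](_ : _ = +oo%E) ?leey//.
  apply/eqP; rewrite /gibbs_objective /entropy oppeK !dadde_eq_pinfty.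
  by apply/orP; left; apply/orP; left; rewrite /qexpectation uy.
(* By [u_ge], the nonnegative differences [tnth l m * q l - v m l] add up to at most 2 (u - h); the
   n-th one alone is then bounded by this integrable function. *)
have iv n : I (v n).
  have inorm f : I f -> I (fun l => `|f l|) by exact: integrable_norm.
  apply: (integrableR_le mD (mv n)) (integrableR_D mD iLam
    (integrableR_D mD (integrableR_Z mD 2 (inorm _ iu))
      (integrableR_Z mD 2 (inorm _ ih)))) _ => l Dl /=.
  have := ler_norm (u l); have := ler_norm (- h l); rewrite normrN => h1 u1.
  have := Lam_ge n l Dl; have := v_le n l Dl; have := u_ge l Dl.
  have : \sum_m v m l - v n l <= Lam l - tnth l n * q l.
    rewrite /Lam (bigD1 n)//= [X in _ <= X - _](bigD1 n)//= !(addrC _ (\sum_(_ | _) _)) !addrK.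
    by apply: ler_sum => m _; exact: v_le.
  have := normr_ge0 (u l); have := normr_ge0 (h l); have := lq0 n l Dl.
  by rewrite ler_norml => *; apply/andP; split; lra.
have [iint ->] := gibbs_objectiveE dq iu iv is_.
have igb := ig b b0.
have q1' : \int[mu]_(l in D) q l = 1 by rewrite /Rintegral q1.
have g1' : \int[mu]_(l in D) prod_rig_pdf b l = 1.
  by rewrite /Rintegral; have [_ _ ->] := is_density_prod_rig_pdf b0.
pose S := \sum_n (a n + b n).
have iSq := integrableR_Z mD S iq.
have igN := integrableR_Z mD (-1) igb.
have iqg := integrableR_D mD iq igN.
rewrite lee_fin -/S.
(* Both densities have mass 1, so S is the integral of the pointwise minorant given by
   [gibbs_pointwise] and [integrandE]. *)
have {1}-> : S = \int[mu]_(l in D) (q l + (-1) * prod_rig_pdf b l + S * q l).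
  rewrite (RintegralD mD iqg iSq) (RintegralD mD iq igN) !RintegralZl// q1' g1'.
  by rewrite !mulr1 subrr add0r.
apply: (le_Rintegral mD (integrableR_D mD iqg iSq) iint) => l Dl.
rewrite integrandE -/S.
have := gibbs_pointwise (prod_rig_logpdf b l) (q0 l Dl); rewrite -[expR _]/(prod_rig_pdf b l).
lra.
Qed.

Lemma gibbs_objective_prod_rig a b : (forall n, 0 <= b n) ->
  gibbs_objective a b (prod_rig_pdf b) = (\sum_n (a n + b n))%:E.
Proof.
move=> b0; have dg := is_density_prod_rig_pdf b0; have [mg g0 g1] := dg.
pose W n l := rig_weight (b n) (tnth l n) * prod_rig_pdf b l.
have iW n : I (W n).
  have mW : measurable_fun D (W n).
    apply: measurable_funTS; apply: measurable_funM.
      by apply: measurable_fun_coord; exact: measurable_rig_weight.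
    exact: measurable_prod_rig_pdf.
  have W0 l : D l -> 0 <= W n l.
    by move=> Dl; rewrite mulr_ge0 ?rig_weight_ge0 ?expR_ge0.
  apply: (integrable_of_fin_num mD); first exact/measurable_EFinP.
  (* The weight sits in coordinate [n] only; all other factors integrate to 1. *)
  pose f i x := (if i == n then rig_weight (b n) x else 1) * rig_pdf (b i) x.
  have -> : (\int[mu]_(l in D) (EFin \o W n) l =
      \int[mu]_(l in D) (\prod_(i < N) f i (tnth l i))%:E)%E.
    apply: eq_integral => l _; congr EFin.
    rewrite /W prod_rig_pdfE big_split/=; congr (_ * _).
    by rewrite (bigD1 n)//= eqxx big1 ?mulr1// => i /negbTE ->.
  rewrite orthant_integral_prod; last 2 first.
  - move=> i; apply: measurable_funM; last exact: measurable_rig_pdf.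
    by case: eqP => // _; exact: measurable_rig_weight.
  - move=> i x x0; apply: mulr_ge0; last exact: expR_ge0.
    by case: eqP => // _; exact: rig_weight_ge0.
  apply: prode_fin_num => i _; rewrite /f; case: eqP => [->|_].
    rewrite ge0_fin_numE ?integral_rig_weight_lty//.
    apply: integral_ge0 => x /=; rewrite in_itv/= andbT lee_fin => x0.
    by rewrite mulr_ge0 ?rig_weight_ge0 ?expR_ge0.
  by under eq_integral do rewrite mul1r; rewrite integral_rig_pdf.
have ig : I (prod_rig_pdf b).
  by apply: (integrable_of_fin_num mD); [exact/measurable_EFinP|rewrite g1].
have mcoord (f : R -> R) n : measurable_fun setT f ->
    measurable_fun D (fun l => f (tnth l n) * prod_rig_pdf b l).
  move=> mf; apply: measurable_funM => //; apply: measurable_funTS.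
  exact: measurable_fun_coord.
have iv n : I (fun l => ln (tnth l n) * prod_rig_pdf b l).
  apply: (integrableR_le mD (mcoord _ n (@measurable_ln R)) (iW n)) => l Dl.
  rewrite normrM (ger0_norm (g0 l Dl)) ler_wpM2r ?g0// /rig_weight.
  have : 0 <= b n ^+ 2 / tnth l n by rewrite divr_ge0 ?sqr_ge0// ltW// Dl.
  by have := Dl n; lra.
have iS n : I (fun l => quadratic_term (a n) (b n) (tnth l n) * prod_rig_pdf b l).
  apply: (integrableR_le mD (mcoord _ n (measurable_quadratic_term _ _))
    (integrableR_D mD (iW n) (integrableR_Z mD `|a n| ig))) => l Dl.
  rewrite normrM (ger0_norm (g0 l Dl)) /W -mulrDl ler_wpM2r ?g0//.
  have l0 := Dl n; have b2 : 0 <= b n ^+ 2 / tnth l n.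
    by rewrite divr_ge0 ?sqr_ge0// ltW.
  have -> : quadratic_term (a n) (b n) (tnth l n) =
      tnth l n / 2 + a n + b n ^+ 2 / tnth l n / 2.
    by rewrite /quadratic_term; field; rewrite gt_eqF.
  have := normr_ge0 (ln (tnth l n)); have := ler_norm (a n).
  have := ler_norm (- a n); rewrite normrN /rig_weight ler_norml => *.
  by apply/andP; split; lra.
pose S := \sum_n (a n + b n).
have iT := integrableR_sum mD (fun n =>
  integrableR_D mD (integrableR_Z mD 2^-1 (iv n)) (iS n)).
(* For this density the two logarithmic terms of [integrandE] cancel, leaving S times the density;
   solving for the entropy term writes it as a combination of integrable functions. *)
have iu : I (fun l => ln (prod_rig_pdf b l) * prod_rig_pdf b l).
  have := integrableR_D mD (integrableR_D mD (integrableR_Z mD S ig)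
    (integrableR_Z mD (-1) iT)) (integrableR_Z mD (- log_const) ig).
  apply: eq_integrable => // l _ /=; congr EFin.
  have := integrandE a b (prod_rig_pdf b) l.
  rewrite /integrand -/S {3}/prod_rig_pdf expRK [prod_rig_logpdf _ _ * _]mulrC; lra.
have [iint ->] := gibbs_objectiveE dg iu iv iS.
congr EFin; transitivity (\int[mu]_(l in D) (S * prod_rig_pdf b l)).
  apply: eq_Rintegral => l _; rewrite integrandE -/S {1}/prod_rig_pdf expRK.
  by rewrite [prod_rig_logpdf _ _ * _]mulrC subrr add0r.
by rewrite RintegralZl// /Rintegral g1 mulr1.
Qed.

End gibbs.

(** * First and second moments under the corrupting distribution *)

Section moments.
Context d (Omega : measurableType d) (R : realType) (P : probability Omega R).
Let I (f : Omega -> R) := P.-integrable setT (EFin \o f).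

Let I_cst (k : R) : I (fun=> k).
Proof. exact: finite_measure_integrable_cst. Qed.

Let int_cst (k : R) : (\int[P]_t k)%R = k.
Proof. by rewrite /Rintegral integral_cst//= probability_setT mule1. Qed.

Let expectationE (f : Omega -> R) : I f -> 'E_P[f]%E = (\int[P]_t f t)%:E.
Proof.
by move=> fi; rewrite unlock /Rintegral fineK//; exact: integrable_fin_num.
Qed.

(** The variance of |Y|, the mean of (|Y| - m)^2, is nonnegative. *)
Lemma abs_mean_le_second_moment (Y : Omega -> R) : I Y -> I (fun t => Y t ^+ 2) ->
  \int[P]_t `|Y t| <= Num.sqrt (\int[P]_t (Y t ^+ 2)).
Proof.
move=> iY iY2; pose m := \int[P]_t `|Y t|.
have iN : I (fun t => `|Y t|) by exact: integrable_norm.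
have m0 : 0 <= m by apply: Rintegral_ge0 => t _; exact: normr_ge0.
rewrite -/m -(ger0_norm m0) -sqrtr_sqr ler_wsqrtr//.
have iD := integrableR_D measurableT iY2 (integrableR_Z measurableT (- (2 * m)) iN).
have : 0 <= \int[P]_t (Y t ^+ 2 + - (2 * m) * `|Y t| + m ^+ 2).
  apply: Rintegral_ge0 => t _.
  rewrite (_ : _ + _ = (`|Y t| - m) ^+ 2) ?sqr_ge0// -(real_normK (num_real (Y t))).
  by ring.
rewrite (RintegralD measurableT iD (I_cst _)) (RintegralD measurableT iY2
  (integrableR_Z measurableT _ iN)) (RintegralZl _ measurableT iN) int_cst -/m.
by rewrite mulNr -mulrA -!expr2; lra.
Qed.

Lemma second_moment_shift (Y : Omega -> R) (l : R) : I Y -> I (fun t => Y t ^+ 2) ->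
  'E_P[fun t => ((l + Y t) ^+ 2)%R]%E =
  (l ^+ 2 + 2 * (\int[P]_t Y t) * l + \int[P]_t (Y t ^+ 2))%:E.
Proof.
move=> iY iY2.
have iZ := integrableR_Z measurableT (2 * l) iY.
have iD := integrableR_D measurableT (I_cst (l ^+ 2)) iZ.
have -> : (fun t => ((l + Y t) ^+ 2)%R) =
    (fun t => l ^+ 2 + 2 * l * Y t + Y t ^+ 2).
  by apply/funext => t; ring.
rewrite expectationE; last exact: (integrableR_D measurableT iD iY2).
rewrite (RintegralD measurableT iD iY2) (RintegralD measurableT (I_cst _) iZ).
by rewrite (RintegralZl _ measurableT iY) int_cst mulrAC.
Qed.

(** A finite value would make Y^2 integrable, since 2 (l + Y)^2 + 2 l^2 - Y^2 = (Y + 2 l)^2 >= 0. *)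
Lemma second_moment_shift_pinfty (Y : Omega -> R) (l : R) :
  measurable_fun setT Y -> ~ I (fun t => Y t ^+ 2) ->
  'E_P[fun t => ((l + Y t) ^+ 2)%R]%E = +oo%E.
Proof.
move=> mY niY2; rewrite unlock.
have mlY : measurable_fun setT (EFin \o (fun t => (l + Y t) ^+ 2)).
  by apply/measurable_EFinP; apply: measurable_funX; exact: measurable_funD.
have [iY|//] := @integrable_or_integral_pinfty _ _ _ P setT measurableT
  (EFin \o (fun t => (l + Y t) ^+ 2)) (EFin \o (fun=> 0))
  mlY (I_cst 0)
  (fun t _ => sqr_ge0 (l + Y t) : (0%:E <= ((l + Y t) ^+ 2)%:E)%E).
exfalso; apply: niY2.
apply: (integrableR_le measurableT _ (integrableR_D measurableT
  (integrableR_Z measurableT 2 iY) (I_cst (2 * l ^+ 2)))) => [|t _].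
  exact: measurable_funX.
rewrite ger0_norm ?sqr_ge0// -subr_ge0.
rewrite (_ : _ - _ = (Y t + 2 * l) ^+ 2) ?sqr_ge0//; ring.
Qed.

(** From 2 max(0, y) = y + |y|, with [c >= 0] moved inside the absolute value. *)
Lemma expectation_max0 (Y : Omega -> R) (c : R) : 0 <= c -> I Y ->
  (2 * c * (\int[P]_t Num.max 0 (Y t)) =
   \int[P]_t (c * Y t) + \int[P]_t `|c * Y t|) /\ I (fun t => Num.max 0 (Y t)).
Proof.
move=> c0 iY.
have iN f : I f -> I (fun t => `|f t|) by exact: integrable_norm.
have icY := integrableR_Z measurableT c iY.
have imax : I (fun t => Num.max 0 (Y t)).
  apply: (integrableR_le measurableT _ (iN _ iY)) => [|t _].
    apply: measurable_maxr => //.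
    by apply/measurable_EFinP; exact: (measurable_int P iY).
  by case: (leP 0 (Y t)) => //; rewrite normr0.
split => //.
rewrite -(RintegralD measurableT icY (iN _ icY)) -(RintegralZl _ measurableT imax).
apply: eq_Rintegral => t _; case: (leP 0 (Y t)) => Y0.
  by rewrite ger0_norm ?mulr_ge0//; ring.
by rewrite normrM (ger0_norm c0) ltr0_norm//; ring.
Qed.

End moments.

(** * The variational bound, in general and without noise *)

Section bound.
Context d (Omega : measurableType d) (R : realType) (P : probability Omega R).
Context (N D : nat) (c ell : R) (y : 'I_N -> R) (X : 'I_N -> 'I_D -> {RV P >-> R}).
Context (w : 'rV[R]_D).
Hypothesis c0 : 0 <= c.
Hypothesis intX : forall n j, P.-integrable setT (EFin \o X n j).

Let I (f : Omega -> R) := P.-integrable setT (EFin \o f).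
Let Y n t := c * zeta ell y X w n t.
Let a n := \int[P]_t Y n t.
(** Meaningful only for an integrable square: otherwise the real-valued integral takes the default
    value 0. *)
Let b n := Num.sqrt (\int[P]_t (Y n t ^+ 2)).

Let zetaE n : zeta ell y X w n =
  fun t => ell + - y n * (\sum_j w 0 j * X n j t).
Proof.
apply/funext => t; rewrite /zeta mulNr; congr (_ - _ * _).
by apply: eq_bigr => j _; rewrite mxE.
Qed.

Lemma integrable_zeta n : I (zeta ell y X w n).
Proof.
rewrite zetaE; apply: (integrableR_D measurableT).
  exact: finite_measure_integrable_cst.
apply: (integrableR_Z measurableT); apply: (integrableR_sum measurableT) => j.
exact: (integrableR_Z measurableT _ (intX n j)).
Qed.

Let iY n : I (Y n).
Proof. exact: (integrableR_Z measurableT c (integrable_zeta n)). Qed.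

Let mY n : measurable_fun setT (Y n).
Proof. by apply/measurable_EFinP; exact: (measurable_int P (iY n)). Qed.

Lemma variational_bound_finite q : (forall n, I (fun t => Y n t ^+ 2)) ->
  variational_bound c ell y X (@log_const R N) w q = gibbs_objective a b q.
Proof.
move=> iY2; rewrite /variational_bound /gibbs_objective; congr (_ + _ + _)%dE.
apply: eq_bigr => n _; congr (_ + _)%dE; apply: eq_integral => l.
rewrite inE => Dl; have l0 := Dl n; congr (_ * _)%E.
rewrite (second_moment_shift _ (iY n) (iY2 n)) -/(a n) -EFinM; congr EFin.
have -> : \int[P]_t (Y n t ^+ 2) = b n ^+ 2.
  by rewrite sqr_sqrtr//; apply: Rintegral_ge0 => t _; exact: sqr_ge0.
by rewrite /quadratic_term; field; rewrite gt_eqF.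
Qed.

(** The inner expectation is +oo for every l in the orthant, and integrating +oo against a density
    of mass 1 gives +oo; points where [q] vanishes contribute 0. *)
Lemma variational_bound_infinite q n : ~ I (fun t => Y n t ^+ 2) -> is_density q ->
  variational_bound c ell y X (@log_const R N) w q = +oo%E.
Proof.
move=> niY2 [mq q0 q1].
apply/eqP; rewrite /variational_bound !dadde_eq_pinfty; apply/orP; left.
apply/orP; right; rewrite (bigD1 n)//= dadde_eq_pinfty; apply/orP; left.
rewrite dadde_eq_pinfty; apply/orP; right; apply/eqP.
transitivity (\int[lebesgue_tuple N]_(l in positive_orthant (N := N))
    (+oo * (q l)%:E))%E; last first.
  rewrite ge0_integralZl ?q1 ?mule1//.
  - exact: measurable_positive_orthant.
  - exact/measurable_EFinP.
apply: eq_integral => l; rewrite inE => Dl.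
rewrite (second_moment_shift_pinfty _ (mY n) niY2).
by rewrite gt0_muley// lte_fin invr_gt0 mulr_gt0.
Qed.

Let abs_a_le_b n : I (fun t => Y n t ^+ 2) -> `|a n| <= b n.
Proof.
move=> iY2; apply: le_trans (abs_mean_le_second_moment (iY n) iY2).
exact: (le_normr_Rintegral measurableT (iY n)).
Qed.

Lemma expected_hingeE :
  ((2 * c)%:E * expected_hinge ell y X w =
   (\sum_n (a n + \int[P]_t `|Y n t|))%:E)%E.
Proof.
have imax n := (expectation_max0 c0 (integrable_zeta n)).2.
transitivity ((2 * c)%:E * (\sum_n \int[P]_t Num.max 0 (zeta ell y X w n t))%:E)%E.
  congr (_ * _)%E; rewrite -sumEFin; apply: eq_bigr => n _.
  rewrite unlock /Rintegral fineK//.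
  exact: (integrable_fin_num measurableT (imax n)).
rewrite -EFinM; congr EFin; rewrite mulr_sumr; apply: eq_bigr => n _.
exact: (expectation_max0 c0 (integrable_zeta n)).1.
Qed.

Lemma variational_bound_ge q : is_density q ->
  ((2 * c)%:E * expected_hinge ell y X w
   <= variational_bound c ell y X (@log_const R N) w q)%E.
Proof.
move=> dq; have [iY2|/existsNP[n niY2]] := pselect (forall n, I (fun t => Y n t ^+ 2)).
  rewrite variational_bound_finite// expected_hingeE.
  apply: le_trans (gibbs_objective_ge _ dq); last by move=> n; exact: abs_a_le_b.
  rewrite lee_fin; apply: ler_sum => n _; rewrite lerD2l.
  exact: (abs_mean_le_second_moment (iY n) (iY2 n)).
by rewrite (variational_bound_infinite niY2 dq) leey.
Qed.

Section noiseless.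
Variable x : 'I_N -> 'rV[R]_D.
Hypothesis Xx : noiseless x X.

Let y0 n := c * (ell - y n * dotv w (x n)).

Let YE n : {ae P, forall t, Y n t = y0 n}.
Proof.
have : {ae P, forall t, forall j, X n j t = x n 0 j}.
  by apply: filter_forall => j; exact: Xx.
apply: filterS => t Xt; rewrite /Y /zeta /y0; congr (_ * (_ - _ * _)).
by apply: eq_bigr => j _; rewrite mxE Xt.
Qed.

Let integral_ae (f : R -> R) n : measurable_fun setT f ->
  (\int[P]_t (f (Y n t))%:E = (f (y0 n))%:E)%E.
Proof.
move=> mf; rewrite (ae_eq_integral (cst (f (y0 n))%:E))//.
- by rewrite integral_cst//= probability_setT mule1.
- by apply/measurable_EFinP; exact: measurableT_comp.
- by have := YE n; apply: filterS => t + _ => /= ->.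
Qed.

Let msqr : measurable_fun setT (fun z : R => z ^+ 2).
Proof. exact: exprn_measurable. Qed.

Let iY2 n : I (fun t => Y n t ^+ 2).
Proof.
apply: (integrable_of_fin_num measurableT).
  by apply/measurable_EFinP; exact: measurable_funX.
by rewrite (integral_ae n msqr).
Qed.

Let hinge_term n : a n + b n = 2 * c * Num.max 0 (ell - y n * dotv w (x n)).
Proof.
have -> : a n = y0 n by rewrite /a /Rintegral (integral_ae n (f := id)).
have -> : b n = `|y0 n|.
  by rewrite /b /Rintegral (integral_ae n msqr) sqrtr_sqr.
rewrite /y0 normrM (ger0_norm c0); case: leP => h.
  by rewrite ger0_norm//; ring.
by rewrite ltr0_norm//; ring.
Qed.

Lemma noiseless_hingeE : \sum_n (a n + b n) = 2 * c * hinge ell x y w.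
Proof. by rewrite mulr_sumr; apply: eq_bigr => n _; exact: hinge_term. Qed.

Lemma noiseless_variational_bound_ge q : is_density q ->
  ((2 * c * hinge ell x y w)%:E
   <= variational_bound c ell y X (@log_const R N) w q)%E.
Proof.
move=> dq; rewrite -noiseless_hingeE variational_bound_finite//.
by apply: gibbs_objective_ge => // n; exact: abs_a_le_b.
Qed.

(** In the optimal q the coordinates are independent, the n-th being reciprocal inverse Gaussian
    with parameter c |ell - y_n w^T x_n|. *)
Lemma noiseless_variational_bound_attained : exists2 q, is_density q &
  variational_bound c ell y X (@log_const R N) w q = (2 * c * hinge ell x y w)%:E.
Proof.
have b0 n : 0 <= b n by exact: sqrtr_ge0.
exists (prod_rig_pdf b); first exact: is_density_prod_rig_pdf.
by rewrite variational_bound_finite// gibbs_objective_prod_rig// noiseless_hingeE.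
Qed.

End noiseless.
End bound.

Theorem mainTheorem4 (R : realType) (N : nat) :
  exists c' : R,
  forall (D : nat) (d : measure_display) (Omega : measurableType d)
    (P : probability Omega R) (c ell : R) (offset : option 'I_D)
    (x : 'I_N -> 'rV[R]_D) (y : 'I_N -> R)
    (k : 'I_D -> nat) (eta : forall j, 'rV[R]_(k j))
    (p : 'I_D -> R -> probability R R) (X : 'I_N -> 'I_D -> {RV P >-> R}),
  0 <= c -> 1 <= ell -> (forall n, y n = 1 \/ y n = -1) ->
  corruption offset x eta p X ->
  let Lq := variational_bound c ell y X c' in
  let svm := svm_objective offset c ell x y in
  let joint w q := ((sqnorm offset w)%:E + Lq w q)%E in
  (forall (w : 'rV[R]_D) (q : N.-tuple R -> R), is_density q ->
     ((2 * c)%:E * expected_hinge ell y X w <= Lq w q)%E) /\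
  (noiseless x X ->
    [/\ (* min_q Lq w q = 2 c * hinge loss, attained *)
        forall w : 'rV[R]_D,
          (exists2 q, is_density q & Lq w q = (2 * c * hinge ell x y w)%:E) /\
          (forall q, is_density q -> ((2 * c * hinge ell x y w)%:E <= Lq w q)%E),
        (* same infimum *)
        ereal_inf [set z | exists w q, is_density q /\ z = joint w q] =
          ereal_inf [set (svm w)%:E | w in setT]
      & (* same minimizers in w *)
        forall w : 'rV[R]_D,
          (exists2 q, is_density q &
             forall w' q', is_density q' -> (joint w q <= joint w' q')%E) <->
          (forall w', svm w <= svm w')]).
Proof.
exists (@log_const R N) => D d Omega P c ell offset x y k eta p X c0 _ _ corr.
(* Unbiasedness gives each corrupted feature a finite mean, hence integrability. *)
have intX n j : P.-integrable setT (EFin \o X n j).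
  apply: (integrable_of_fin_num measurableT).
    by apply/measurable_EFinP; exact: measurable_funPT.
  by have := corruption_unbiased corr n j; rewrite unlock => ->.
move=> Lq svm joint; split=> [w q dq|Xx]; first exact: variational_bound_ge.
have Lge w q : is_density q -> ((2 * c * hinge ell x y w)%:E <= Lq w q)%E.
  exact: noiseless_variational_bound_ge.
have Latt w : exists2 q, is_density q & Lq w q = (2 * c * hinge ell x y w)%:E.
  exact: noiseless_variational_bound_attained.
(* For fixed [w], the minimum of [joint w] over densities is [svm w], and it is attained; the claims
   on infima and minimizers follow formally. *)
have joint_ge w q : is_density q -> ((svm w)%:E <= joint w q)%E.
  by move=> dq; rewrite /svm /svm_objective EFinD leeD2l//; exact: Lge.
have joint_att w : exists2 q, is_density q & joint w q = (svm w)%:E.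
  by have [q dq Lqw] := Latt w; exists q => //; rewrite /joint Lqw -EFinD.
split.
- by move=> w; split; [exact: Latt|exact: Lge].
- apply/eqP; rewrite eq_le; apply/andP; split; apply: le_ereal_inf_tmp.
    move=> _ [w _ <-]; apply: ereal_inf_lbound.
    by have [q dq jq] := joint_att w; exists w, q.
  move=> _ [w [q [dq ->]]]; apply: le_trans (joint_ge w q dq).
  by apply: ereal_inf_lbound; exists w.
- move=> w; split=> [[q dq jmin] w'|smin].
    have [q' dq' jq'] := joint_att w'.
    by rewrite -lee_fin -jq'; apply: le_trans (joint_ge w q dq) (jmin _ _ dq').
  have [q dq jq] := joint_att w; exists q => // w' q' dq'.
  by rewrite jq; apply: le_trans (joint_ge w' q' dq'); rewrite lee_fin.
Qed.
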